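(* Let $G$ be a connected graph. Then (i) $Z(G) \leq F_d(G) \leq Z(G)+\gamma(G)$, and (ii) $\gamma(G) \leq F_d(G) \leq Z(G)+\gamma(G)$.
   Context: Graphs are finite, simple, undirected and have at least one vertex. Zero forcing: given a set $B\subseteq V(G)$ of initially black vertices (all others white), at each step a black vertex having exactly one white neighbor forces that neighbor to become black; $B$ is a zero forcing set of $G$ if repeated application of this rule turns all vertices black. $Z(G)$ is the minimum cardinality of a zero forcing set. A set $D\subseteq V(G)$ is dominating if every vertex of $G$ is in $D$ or adjacent to a vertex of $D$; $\gamma(G)$ is the minimum cardinality of a dominating set. A dom-forcing set of $G$ is a set $D_f\subseteq V(G)$ that is both a dominating set of $G$ and a zero forcing set of $G$; the dom-forcing number $F_d(G)$ is the minimum cardinality of a dom-forcing set. *)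

(* Defs.v *)
From mathcomp Require Import all_boot.

Set Implicit Arguments.
Unset Strict Implicit.
Unset Printing Implicit Defensive.

(* A simple graph is given by a finite vertex type T and a symmetric,
   irreflexive adjacency relation e; both properties are assumed where needed. *)

Definition connected_graph (T : finType) (e : rel T) : Prop :=
  0 < #|T| /\ forall x y : T, connect e x y.

Definition white_neighbors (T : finType) (e : rel T) (S : {set T}) (u : T) :
  {set T} := [set v | e u v & v \notin S].

(* S and S' are the sets of black vertices before and after a single force. *)
Definition force_step (T : finType) (e : rel T) : rel {set T} :=
  fun S S' =>
    [exists u in S, exists v,
       (white_neighbors e S u == [set v]) && (S' == v |: S)].

(* [connect] is the reflexive transitive closure, here of a relation on {set T}:
   some finite sequence of forces starting from B turns all vertices black. *)
Definition zero_forcing (T : finType) (e : rel T) (B : {set T}) : bool :=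
  connect (force_step e) B [set: T].

Definition dominating (T : finType) (e : rel T) (D : {set T}) : bool :=
  [forall v, (v \in D) || [exists u in D, e u v]].

Definition dom_forcing (T : finType) (e : rel T) (D : {set T}) : bool :=
  dominating e D && zero_forcing e D.

(* The minimum of #|S| over the sets S satisfying P. The default [set: T] of
   [arg min] must satisfy P; see the three lemmas on [set: T] below. *)
Definition min_card (T : finType) (P : pred {set T}) : nat :=
  #|[arg min_(S < [set: T] | P S) #|S|]|.

Definition zero_forcing_number (T : finType) (e : rel T) : nat :=
  min_card (zero_forcing e).

Definition domination_number (T : finType) (e : rel T) : nat :=
  min_card (dominating e).

Definition dom_forcing_number (T : finType) (e : rel T) : nat :=
  min_card (dom_forcing e).

Lemma zero_forcing_setT (T : finType) (e : rel T) : zero_forcing e [set: T].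
Proof. exact: connect0. Qed.

Lemma dominating_setT (T : finType) (e : rel T) : dominating e [set: T].
Proof. by apply/forallP => v; rewrite inE. Qed.

Lemma dom_forcing_setT (T : finType) (e : rel T) : dom_forcing e [set: T].
Proof. by rewrite /dom_forcing dominating_setT zero_forcing_setT. Qed.

Lemma min_cardP (T : finType) (P : pred {set T}) : P [set: T] ->
  (exists2 S, P S & #|S| = min_card P) /\ (forall S, P S -> min_card P <= #|S|).
Proof.
rewrite /min_card => PT; case: arg_minnP => // S PS minS.
by split=> //; exists S.
Qed.

(* Main.v *)
Require Import Defs.
From mathcomp Require Import all_boot.

(* A superset of a zero forcing set can follow the same sequence of forces,
   skipping those whose target is already black. Hence the union of a minimum
   zero forcing set and a minimum dominating set is dom-forcing. *)

Lemma force_step_superset (T : finType) (e : rel T) (S S' W : {set T}) :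
  force_step e S S' -> S \subset W ->
  exists2 W' : {set T}, connect (force_step e) W W' & S' \subset W'.
Proof.
case/exists_inP => u uS /existsP [v /andP [/eqP Nu /eqP ->]] SW.
have [vW | vNW] := boolP (v \in W).
  (* The force is skipped: its target is already black in [W]. *)
  by exists W; rewrite ?connect0 // subUset sub1set vW.
(* Otherwise [u] can still force [v]: enlarging the black set only removes white neighbors of [u],
   and [v] itself is still white. *)
exists (v |: W); last exact: setUS.
apply/connect1/exists_inP; exists u; first exact: (subsetP SW).
apply/existsP; exists v; rewrite eqxx andbT eqEsubset.
apply/andP; split.
  rewrite -Nu; apply/subsetP => w; rewrite !inE => /andP [-> /=].
  by apply: contra; apply: (subsetP SW).
have : v \in white_neighbors e S u by rewrite Nu set11.
by rewrite sub1set !inE vNW => /andP [->].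
Qed.

Lemma zero_forcing_superset (T : finType) (e : rel T) (B W : {set T}) :
  B \subset W -> zero_forcing e B -> zero_forcing e W.
Proof.
(* Induction on the sequence of forces, with [B] and [W] general since both may grow at each
   force. *)
move=> + /connectP [p]; elim: p B W => [|S p IHp] B W BW /=.
  move=> _ TB; move: BW; rewrite -TB subTset => /eqP ->.
  exact: zero_forcing_setT.
case/andP => BS pathp lastp.
have [W' WW' SW'] := force_step_superset T e B S W BS BW.
exact: connect_trans WW' (IHp S W' SW' pathp lastp).
Qed.

Lemma dominating_superset (T : finType) (e : rel T) (D W : {set T}) :
  D \subset W -> dominating e D -> dominating e W.
Proof.
move=> /subsetP DW /forallP domD; apply/forallP => v.
case/orP: (domD v) => [/DW -> // | /exists_inP [u /DW uW euv]].
by apply/orP; right; apply/exists_inP; exists u.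
Qed.

Theorem proposition1p2 (T : finType) (e : rel T)
    (e_sym : symmetric e) (e_irr : irreflexive e)
    (e_conn : connected_graph e) :
  (zero_forcing_number e <= dom_forcing_number e
     <= zero_forcing_number e + domination_number e)
  /\
  (domination_number e <= dom_forcing_number e
     <= zero_forcing_number e + domination_number e).
Proof.
have [[B zfB cardB] minZ] := min_cardP (zero_forcing_setT e).
have [[D domD cardD] minG] := min_cardP (dominating_setT e).
have [[F /andP [domF zfF] cardF] minF] := min_cardP (dom_forcing_setT e).
rewrite /zero_forcing_number /domination_number /dom_forcing_number.
(* Both conjuncts share this upper bound, so one rewrite settles it in each. The witness is
   [B :|: D]. *)
have -> : min_card (dom_forcing e)
    <= min_card (zero_forcing e) + min_card (dominating e).
  rewrite -cardB -cardD; apply: leq_trans (leq_card_setU B D); apply: minF.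
  apply/andP; split; first exact: dominating_superset (subsetUr B D) domD.
  exact: zero_forcing_superset (subsetUl B D) zfB.
(* For the lower bounds, the minimum dom-forcing set [F] is itself a candidate in both other
   minima. *)
by rewrite !andbT -cardF minZ // minG.
Qed.
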